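(* Let $d$ be a constant, let $\beta>0$ be a fixed constant, and let $\mathcal{P}$ be a set of stochastic points in $\mathbb{R}^d$ in the existential uncertainty model such that $p_v\ge\beta$ for every $v\in\mathcal{P}$. Then for every $\varepsilon>0$ there is an $\varepsilon$-exp-kernel of $\mathcal{P}$ of size $O\!\left(\frac{1}{\varepsilon^{(d-1)/2}}\log\frac{1}{\varepsilon}\right)$ which satisfies the subset constraint.
   Context: Existential model: each $v\in\mathcal{P}$ is present in a random realization $P\sim\mathcal{P}$ independently with probability $p_v$. For a finite point set $P$, $f(P,u)=\max_{p\in P}\langle u,p\rangle$ (with $f(\emptyset,u)=0$), $\omega(P,u)=f(P,u)+f(P,-u)$, and $\omega(\mathcal{P},u)=\mathbb{E}_{P\sim\mathcal{P}}[\omega(P,u)]$. A set $S$ of stochastic points is an $\varepsilon$-exp-kernel of $\mathcal{P}$ if $(1-\varepsilon)\omega(\mathcal{P},u)\le\omega(S,u)\le\omega(\mathcal{P},u)$ for all $u\in\mathbb{R}^d$. The subset constraint requires that $S$ be a subset of $\mathcal{P}$ in which each chosen point keeps its original existence probability (independently). *)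

(* Defs.v *)
From HB Require Import structures.
From mathcomp Require Export all_boot all_order all_algebra.
From mathcomp Require Export finmap.
From mathcomp Require Export all_classical all_reals all_analysis.

Set Implicit Arguments.
Unset Strict Implicit.
Unset Printing Implicit Defensive.

Import Order.TTheory GRing.Theory Num.Theory.
Import numFieldNormedType.Exports.

Local Open Scope ring_scope.

Definition dot (R : realType) (d : nat) (u v : 'rV[R]_d) : R :=
  \sum_(i < d) u ord0 i * v ord0 i.

(* The maximum may be negative, so it is folded from the value at the first
   point and not from 0; only the empty set gets the default 0. *)
Definition support_fun (R : realType) (d : nat)
    (P : {fset 'rV[R]_d}) (u : 'rV[R]_d) : R :=
  if enum_fset P is v :: s then \big[Num.max/dot u v]_(w <- s) dot u w else 0.

Definition width (R : realType) (d : nat)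
    (P : {fset 'rV[R]_d}) (u : 'rV[R]_d) : R :=
  support_fun P u + support_fun P (- u).

(* A finite set of stochastic points in the existential model. Its elements
   are labels carrying a location and an existence probability, so that two
   different stochastic points are allowed to share a location; a plain set of
   points of R^d is the case where [loc] is injective. *)
Record stoch_points (R : realType) (d : nat) := StochPoints {
  stoch_label :> finType;
  loc : stoch_label -> 'rV[R]_d;
  prob : stoch_label -> R;
  prob_itv : forall v, 0 <= prob v <= 1
}.

(* Probability that exactly the points of [A] are present. *)
Definition realization_prob (R : realType) (d : nat) (P : stoch_points R d)
    (A : {set P}) : R :=
  (\prod_(v in A) prob v) * (\prod_(v in ~: A) (1 - prob v)).

Definition realization (R : realType) (d : nat) (P : stoch_points R d)
    (A : {set P}) : {fset 'rV[R]_d} :=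
  [fset loc v | v in A]%fset.

Definition expect (R : realType) (d : nat) (P : stoch_points R d)
    (X : {fset 'rV[R]_d} -> R) : R :=
  \sum_(A : {set P}) realization_prob A * X (realization A).

Definition exp_width (R : realType) (d : nat) (P : stoch_points R d)
    (u : 'rV[R]_d) : R :=
  expect P (fun A => width A u).

Definition exp_kernel (R : realType) (d : nat) (eps : R)
    (S P : stoch_points R d) : Prop :=
  forall u : 'rV[R]_d,
    (1 - eps) * exp_width P u <= exp_width S u <= exp_width P u.

(* [S] is a subset of [P], the inclusion [h] preserving locations and existence
   probabilities; independence within [S] is built into [expect]. *)
Definition subset_constraint (R : realType) (d : nat)
    (S P : stoch_points R d) : Prop :=
  exists h : S -> P,
    [/\ injective h,
        forall v, loc (h v) = loc v
      & forall v, prob (h v) = prob v].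

(* Main.v *)
(** The stochastic kernel is obtained by peeling: extract a deterministic
    [eta]-kernel of size O(eta^(-(d-1)/2)) from the points, remove it, and repeat
    [k] times. Fix a direction [u] and let [W] be the width of the whole point set.
    If the extreme point of a realization was not peeled off, then each of the [k]
    layers holds a point that is at most [eta W] less extreme, and with probability
    at least 1 - (1-beta)^k one of these points is present. Hence the expected
    width drops by at most 2 (eta + (1-beta)^k) W, while it is at least beta^2 W
    because both extreme points are present with probability at least beta^2. So
    eta ~ eps and k ~ log (1/eps) suffice.

    For the deterministic kernel, the coordinates in a barycentric spanner move the
    points into the unit cube while the width bounds the coordinates of the
    direction; then one keeps a nearest point of every node of a grid of mesh
    ~ sqrt eta on the boundary of a larger cube. *)

Require Import Defs.
From HB Require Import structures.
From mathcomp Require Import all_boot all_order all_algebra.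
From mathcomp Require Import finmap.
From mathcomp Require Import all_classical all_reals all_analysis.
From mathcomp Require Import fintype finset ring lra.
Import Order.TTheory GRing.Theory Num.Theory.
Import numFieldNormedType.Exports.

Set Implicit Arguments.
Unset Strict Implicit.
Unset Printing Implicit Defensive.

Local Open Scope ring_scope.

Section SupNorm.
Variables (R : realFieldType) (m n : nat).
Implicit Types A : 'M[R]_(m, n).

Lemma mx_norm_leP A (c : R) : 0 <= c ->
  reflect (forall i j, `|A i j| <= c) (`|A| <= c).
Proof.
move=> c0; rewrite [leLHS]/Num.norm/= mx_normrE.
by apply: (iffP (bigmax_leP _ _ _ _)) => [[_ Ac] i j|Ac]; [exact: (Ac (i, j))|by split].
Qed.

Lemma ler_entry_mx_norm A i j : `|A i j| <= `|A|.
Proof. exact/mx_norm_leP. Qed.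

Lemma mx_norm_attained A : A != 0 -> exists i j, `|A| = `|A i j|.
Proof. by rewrite -normr_eq0 => /mx_norm_neq0[[i j] Aij]; exists i, j. Qed.

End SupNorm.

Section Dot.
Variables (R : realType) (d : nat).
Implicit Types u v w a b : 'rV[R]_d.

Fact dot_is_bilinear : bilinear_for
  (GRing.Scale.Law.clone _ _ *%R _) (GRing.Scale.Law.clone _ _ *%R _) (@dot R d).
Proof.
by split=> u a v w; rewrite /= /dot mulr_sumr -big_split; apply: eq_bigr => i _ /=;
  rewrite !mxE; ring.
Qed.

HB.instance Definition _ := bilinear_isBilinear.Build R _ _ _
  (GRing.Scale.Law.clone _ _ *%R _) (GRing.Scale.Law.clone _ _ *%R _)
  (@dot R d) dot_is_bilinear.

Lemma dotC u v : dot u v = dot v u.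
Proof. by apply: eq_bigr => i _; rewrite mulrC. Qed.

Lemma dotvv_ge0 u : 0 <= dot u u.
Proof. by apply: sumr_ge0 => i _; rewrite -expr2 sqr_ge0. Qed.

Lemma dotvv_le_sqr_norm u : dot u u <= d%:R * `|u| ^+ 2.
Proof.
rewrite /dot mulr_natl -[d in _ *+ d]card_ord -sumr_const.
apply: ler_sum => i _; rewrite -expr2 -real_normK ?num_real//.
by rewrite lerXn2r ?nnegrE// ler_entry_mx_norm.
Qed.

(* If [b] is at least as close as [a] to a point [a + t u + e] lying at distance
   [|e|] from the ray issued from [a] in direction [u], then [b] is almost as
   extreme as [a] in that direction, with an error quadratic in [|e|]. *)
Lemma nearest_point_dot (t : R) u e a b : 0 < t ->
  dot (a + t *: u + e - b) (a + t *: u + e - b) <= dot (t *: u + e) (t *: u + e) ->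
  dot u (a - b) <= dot e e / (2 * t).
Proof.
move=> t0; set z := t *: u + e; set w := a - b.
have -> : a + t *: u + e - b = z + w by apply/rowP => i; rewrite !mxE; ring.
have zw : dot z w = t * dot u w + dot w e by rewrite linearDl linearZl_LR/= (dotC e w).
clearbody z w.
rewrite !(linearDl, linearDr)/= (dotC w z) => h.
have := dotvv_ge0 (w + e); rewrite !(linearDl, linearDr)/= (dotC e w) => h2.
by rewrite ler_pdivlMr ?mulr_gt0//; nra.
Qed.

End Dot.

Lemma cramer_row (F : comUnitRingType) r (A : 'M[F]_r) (y : 'rV_r) k :
  A \in unitmx ->
  (y *m invmx A) ord0 k =
  \det (\matrix_j (if j == k then y else row j A)) / \det A.
Proof.
move=> uA; rewrite /invmx uA -scalemxAr mxE mulrC; congr (_ / _).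
rewrite mxE (expand_det_row _ k); apply: eq_bigr => j _.
rewrite !mxE eqxx; congr (_ * (_ * \det _)).
by apply/matrixP => a b; rewrite !mxE eq_sym (negPf (neq_lift _ _)) mxE.
Qed.

Section BarycentricSpanner.
Variables (R : realFieldType) (I : finType) (D : {set I}).

Definition barycentric_spanner (V : lmodType R) (x : I -> V) (r : nat)
    (v : 'I_r -> I) (l : I -> 'rV[R]_r) : Prop :=
  [/\ forall k, v k \in D, forall i, i \in D -> `|l i| <= 1
    & forall i, i \in D -> x i = \sum_k l i ord0 k *: x (v k)].

Lemma barycentric_spanner_linear (V W : lmodType R) (f : {linear V -> W})
    (x : I -> W) (y : I -> V) r (v : 'I_r -> I) (l : I -> 'rV[R]_r) :
    (forall i, i \in D -> x i = f (y i)) ->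
  barycentric_spanner y v l -> barycentric_spanner x v l.
Proof.
move=> xE [vD l1 yE]; split=> // i iD; rewrite xE// {1}yE// linear_sum.
by apply: eq_bigr => k _; rewrite linearZ xE.
Qed.

Lemma barycentric_spanner_widen (V : lmodType R) (x : I -> V) (r d : nat)
    (v : 'I_r -> I) (l : I -> 'rV[R]_r) :
    (r <= d)%N -> D != set0 -> barycentric_spanner x v l ->
  exists (w : 'I_d -> I) (m : I -> 'rV[R]_d), barycentric_spanner x w m.
Proof.
move=> /subnKC <- /set0Pn[p pD] [vD l1 xE].
exists (fun k => if fintype.split k is inl k' then v k' else p), (fun i => row_mx (l i) 0).
split=> [k|i iD|i iD].
- by case: fintype.split.
- apply/mx_norm_leP => // z k; rewrite (ord1 z) mxE; case: fintype.split => k'.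
    by rewrite (le_trans (ler_entry_mx_norm _ _ _))// l1.
  by rewrite mxE normr0.
- rewrite {1}xE// big_split_ord/= [X in _ + X]big1 ?addr0 => [|k _].
    by apply: eq_bigr => k _; rewrite row_mxEl (unsplitK (inl k)).
  by rewrite row_mxEr mxE scale0r.
Qed.

(* Among the points of [D], take [r] with maximal [`|det|]: by Cramer's rule each
   coordinate of a point is a quotient of determinants, hence at most 1. *)
Lemma barycentric_spanner_full_rank r (y : I -> 'rV[R]_r) (f : 'I_r -> I) :
    (forall k, f k \in D) -> \matrix_k y (f k) \in unitmx ->
  exists (v : 'I_r -> I) (l : I -> 'rV[R]_r), barycentric_spanner y v l.
Proof.
move=> fD f_unit; pose Y (v : 'I_r -> I) := \matrix_k y (v k).
pose inD (v : {ffun 'I_r -> I}) := [forall k, v k \in D].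
have ffD : inD (finfun f) by apply/forallP => k; rewrite ffunE.
case: (@arg_maxP _ _ _ _ inD (fun v => `|\det (Y v)|) ffD) => v /forallP vD v_max.
have detv : 0 < `|\det (Y v)|.
  rewrite (lt_le_trans _ (v_max _ ffD))// normr_gt0 -unitfE -unitmxE.
  by rewrite (_ : Y _ = \matrix_k y (f k))//; apply/row_matrixP => k; rewrite !rowK ffunE.
have Y_unit : Y v \in unitmx by rewrite unitmxE unitfE -normr_gt0.
exists v, (fun i => y i *m invmx (Y v)); split=> // i iD; last first.
  rewrite -{1}(mulmxKV Y_unit (y i)) mulmx_sum_row.
  by apply: eq_bigr => k _; rewrite rowK.
apply/mx_norm_leP => // z k; rewrite (ord1 z).
rewrite cramer_row// normrM normfV ler_pdivrMr// mul1r.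
pose w := [ffun j => if j == k then i else v j].
have wD : inD w by apply/forallP => j; rewrite ffunE; case: ifP.
suff -> : \matrix_j (if j == k then y i else row j (Y v)) = Y w by exact: v_max.
by apply/row_matrixP => j; rewrite !rowK ffunE; case: ifP.
Qed.

Lemma barycentric_spanner_exists d (x : I -> 'rV[R]_d) : D != set0 ->
  exists (v : 'I_d -> I) (l : I -> 'rV[R]_d), barycentric_spanner x v l.
Proof.
move=> D0; pose X := \matrix_(a < #|D|) x (enum_val a).
pose f (k : 'I_(\rank X)) := enum_val (maxrankfun X k).
pose B := rowsub (maxrankfun X) X.
pose y i := x i *m pinvmx B.
have BE : B = \matrix_k x (f k) by apply/row_matrixP => k; rewrite row_rowsub !rowK.
have y_unit : \matrix_k y (f k) \in unitmx.
  suff -> : \matrix_k y (f k) = 1%:M by exact: unitmx1.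
  rewrite -(mulmxVp (maxrowsub_free X)) -/B; apply/row_matrixP => k.
  by rewrite rowK row_mul {1}BE rowK.
have xE i : i \in D -> x i = mulmxr B (y i).
  move=> iD; rewrite /= mulmxKpV// eq_maxrowsub.
  by rewrite -[x i](_ : row (enum_rank_in iD i) X = _) ?row_sub// rowK enum_rankK_in.
have [v [l spanner_y]] := barycentric_spanner_full_rank (fun k => enum_valP _) y_unit.
apply: barycentric_spanner_widen (rank_leq_col X) D0 _.
exact: barycentric_spanner_linear xE spanner_y.
Qed.

End BarycentricSpanner.

(** * Directional width and deterministic kernels *)

Section DirectionalWidth.
Variables (R : realType) (d : nat) (I : finType) (x : I -> 'rV[R]_d).
Implicit Types (A D S T : {set I}) (u : 'rV[R]_d).

Definition dir_width D u : R :=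
  \big[Num.max/0]_(z in setX D D) dot u (x z.1 - x z.2).

Lemma dir_width_ge0 D u : 0 <= dir_width D u.
Proof. exact: bigmax_ge_id. Qed.

Lemma dot_le_dir_width D u a b : a \in D -> b \in D ->
  dot u (x a - x b) <= dir_width D u.
Proof.
move=> aD bD.
by apply: (le_bigmax_cond _ (fun z => dot u (x z.1 - x z.2)) (j := (a, b))); rewrite inE aD.
Qed.

Lemma dir_width_le D u W : 0 <= W ->
  (forall a b, a \in D -> b \in D -> dot u (x a - x b) <= W) -> dir_width D u <= W.
Proof. by move=> W0 DW; apply: bigmax_le => // -[a b] /setXP[]; exact: DW. Qed.

Lemma dir_widthS S D u : S \subset D -> dir_width S u <= dir_width D u.
Proof.
move=> /subsetP SD; apply: dir_width_le => [|a b aS bS]; first exact: dir_width_ge0.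
by apply: dot_le_dir_width; exact: SD.
Qed.

Lemma dir_widthN D u : dir_width D (- u) = dir_width D u.
Proof.
wlog suff le_widthN : u / dir_width D (- u) <= dir_width D u.
  by apply: le_anti; rewrite le_widthN -{1}[u]opprK le_widthN.
apply: dir_width_le => [|a b aD bD]; first exact: dir_width_ge0.
by rewrite linearNl -linearNr opprB dot_le_dir_width.
Qed.

Definition eps_kernel (eps : R) S D : Prop :=
  S \subset D /\ forall u, exists2 j, j \in S &
    forall i, i \in D -> dot u (x i - x j) <= eps * dir_width D u.

Definition extreme_upto (c : R) T D u : Prop :=
  forall i j, i \in D -> j \in T -> dot u (x i - x j) <= c.

(* The first case arises when fewer than [k] layers exhaust [D]. *)
Definition peeled_kernel (eps : R) (k : nat) S D : Prop :=
  S = D \/ S \subset D /\ forall u, exists T : {set I},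
    [/\ T \subset S, #|T| = k & extreme_upto (eps * dir_width D u) T (D :\: S) u].

Lemma peeled_kernel_sub eps k S D : peeled_kernel eps k S D -> S \subset D.
Proof. by case=> [->|[]]. Qed.

Lemma peeled_kernelS eps k S S' D : 0 <= eps ->
    peeled_kernel eps k S D -> eps_kernel eps S' (D :\: S) ->
  peeled_kernel eps k.+1 (S' :|: S) D.
Proof.
move=> eps0 [SD|[SD peeled]] [S'D kerS'].
  by left; rewrite SD; apply/setUidPr; rewrite (subset_trans S'D)// SD subsetDl.
right; split=> [|u]; first by rewrite subUset SD (subset_trans S'D) ?subsetDl.
have [T [TS cardT T_extreme]] := peeled u; have [j jS' j_extreme] := kerS' u.
have /setDP[_ jS] := subsetP S'D j jS'.
exists (j |: T); split.
- by rewrite subUset sub1set inE jS' (subset_trans TS) ?subsetUr.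
- by rewrite cardsU1 cardT (contra (subsetP TS j)).
move=> i j' /setDP[iD]; rewrite inE negb_or => /andP[_ iS].
have iDS : i \in D :\: S by rewrite inE iS.
case/setU1P => [->|]; last exact: T_extreme.
by rewrite (le_trans (j_extreme i iDS))// ler_wpM2l// dir_widthS ?subsetDl.
Qed.

Lemma extreme_upto_setI S T D A u c a :
    0 <= c -> A \subset D -> T \subset S -> extreme_upto c T (D :\: S) u ->
    ~~ [disjoint T & A] -> a \in A ->
  exists2 b, b \in A :&: S & dot u (x a - x b) <= c.
Proof.
move=> c0 AD TS T_extreme /pred0Pn[j /andP[/= jT jA]] aA.
have [aS|aS] := boolP (a \in S).
  by exists a; rewrite ?inE ?aA// subrr linear0r.
exists j; first by rewrite inE jA (subsetP TS).
by apply: T_extreme => //; rewrite inE aS (subsetP AD).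
Qed.

Lemma dir_width_setI_le S T1 T2 D A u c :
    0 <= c -> A \subset D -> T1 \subset S -> T2 \subset S ->
    extreme_upto c T1 (D :\: S) u -> extreme_upto c T2 (D :\: S) (- u) ->
    ~~ [disjoint T1 & A] -> ~~ [disjoint T2 & A] ->
  dir_width A u <= dir_width (A :&: S) u + 2 * c.
Proof.
move=> c0 AD T1S T2S ext1 ext2 meet1 meet2.
apply: dir_width_le => [|a b aA bA]; first by rewrite addr_ge0 ?dir_width_ge0 ?mulr_ge0.
have [a' a'AS aa'] := extreme_upto_setI c0 AD T1S ext1 meet1 aA.
have [b' b'AS bb'] := extreme_upto_setI c0 AD T2S ext2 meet2 bA.
have := dot_le_dir_width u a'AS b'AS.
by move: aa' bb'; rewrite linearNl !linearBr /=; lra.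
Qed.

End DirectionalWidth.

Section CubeFaceGrid.

Definition grid_point (R : realFieldType) (M : R) (n m : nat) : R :=
  - M + 2 * M / n%:R * m%:R.

Lemma grid_point_near (R : archiRealFieldType) (M t : R) (n : nat) :
    0 < M -> (0 < n)%N -> `|t| <= M ->
  exists m : 'I_n.+1, `|grid_point M n m - t| <= 2 * M / n%:R.
Proof.
move=> M0 n0; rewrite -(ltr_nat R) in n0; rewrite ler_norml => /andP[tl tr].
rewrite /grid_point; set mesh := 2 * M / n%:R.
have mesh0 : 0 < mesh by rewrite divr_gt0// mulr_gt0.
have pos0 : 0 <= (t + M) / mesh by rewrite divr_ge0 ?(ltW mesh0)//; lra.
have /andP[] := truncn_itv pos0; set m := Num.truncn _ => m_le m_gt.
have mn : (m < n.+1)%N.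
  rewrite ltnS -(ler_nat R) (le_trans m_le)// ler_pdivrMr// /mesh mulrC divfK ?gt_eqF//.
  by lra.
exists (Ordinal mn) => /=; move: m_le m_gt; rewrite ler_pdivlMr// ltr_pdivrMr// -natr1.
by move=> m_le m_gt; rewrite ler_norml; apply/andP; split; lra.
Qed.

Definition face_node_label (d n : nat) : finType :=
  (bool * 'I_d.+1 * {ffun 'I_d -> 'I_n.+1})%type.

(* Node of a grid on the facet [y_k = L] or [y_k = - L], with the other
   coordinates between [- M] and [M]. *)
Definition face_node (R : realFieldType) (d n : nat) (L M : R)
    (z : face_node_label d n) : 'rV[R]_d.+1 :=
  \row_k (if unlift z.1.2 k is Some m then grid_point M n (z.2 m)
          else (-1) ^+ z.1.1 * L).

Definition net_size (d n : nat) : nat := 2 * d * n.+1 ^ d.-1.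

Lemma card_face_node_label (d n : nat) : #|face_node_label d n| = net_size d.+1 n.
Proof. by rewrite !card_prod card_bool card_ffun !card_ord. Qed.

Lemma face_node_near (R : archiRealFieldType) (d n : nat) (L M : R)
    (y : 'rV[R]_d.+1) (neg : bool) (k : 'I_d.+1) :
    0 < M -> (0 < n)%N -> `|y| <= M -> y ord0 k = (-1) ^+ neg * L ->
  exists z : face_node_label d n, `|face_node L M z - y| <= 2 * M / n%:R.
Proof.
move=> M0 n0 yM yk.
have /fin_all_exists[f f_near] (m : 'I_d) := grid_point_near M0 n0
  (le_trans (ler_entry_mx_norm y ord0 (lift k m)) yM).
exists (neg, k, finfun f); apply/mx_norm_leP => [|i m].
  by rewrite divr_ge0// mulr_ge0// ltW.
rewrite (ord1 i) !mxE /=; case: unliftP => [m' ->|->]; first by rewrite ffunE.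
by rewrite yk subrr normr0 divr_ge0// mulr_ge0// ltW.
Qed.

End CubeFaceGrid.

(* A point nearest to a node at distance at most [sqrt d * 8 / n] from a ray loses
   half the square of this distance, by [nearest_point_dot]. *)
Definition net_error {R : realFieldType} (d n : nat) : R := 32 * d%:R / n%:R ^+ 2.

Lemma net_error_ge0 (R : realFieldType) (d n : nat) : 0 <= net_error d n :> R.
Proof. by rewrite divr_ge0// ?sqr_ge0// mulr_ge0. Qed.

Definition cube_node {R : realFieldType} (d n : nat) :
  face_node_label d n -> 'rV[R]_d.+1 := face_node 2 4.

Section DeterministicKernels.
Variables (R : realType) (d : nat) (I : finType).
Implicit Types (D : {set I}) (x : I -> 'rV[R]_d.+1) (u : 'rV[R]_d.+1).

Lemma ray_meets_face (q u : 'rV[R]_d.+1) : u != 0 -> `|q| <= 1 ->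
  exists (t : R) (neg : bool) (k : 'I_d.+1),
    [/\ 0 < t, t^-1 <= `|u|, `|q + t *: u| <= 4
      & (q + t *: u) ord0 k = (-1) ^+ neg * 2].
Proof.
move=> u0 q1; have [i [k]] := mx_norm_attained u0; rewrite (ord1 i) => uk.
have u_gt0 : 0 < `|u| by rewrite normr_gt0.
pose neg := u ord0 k < 0; pose c := (-1) ^+ neg * q ord0 k.
have /andP[c_ge c_le] : - 1 <= c <= 1.
  by rewrite -ler_norml normrMsign (le_trans (ler_entry_mx_norm _ _ _)).
exists ((2 - c) / `|u|), neg, k; split.
- by rewrite divr_gt0//; lra.
- by rewrite invf_div ler_pdivrMr ?ler_peMr//; lra.
- rewrite (le_trans (ler_normD _ _))// normrZ ger0_norm; last by rewrite divr_ge0//; lra.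
  by rewrite divfK ?gt_eqF//; lra.
rewrite !mxE [u ord0 k]realEsign ?num_real// -/neg -uk mulrCA divfK ?gt_eqF//.
by rewrite mulrBr /c mulrA -expr2 sqrr_sign mul1r addrC subrK.
Qed.

Lemma nearer_face_node_dot (q u : 'rV[R]_d.+1) n : (0 < n)%N -> `|q| <= 1 ->
  exists z : face_node_label d n, forall b,
    dot (cube_node z - b) (cube_node z - b) <= dot (cube_node z - q) (cube_node z - q) ->
    dot u (q - b) <= net_error d.+1 n * `|u|.
Proof.
move=> n0 q1; have [->|u0] := eqVneq u 0.
  by exists (true, ord0, [ffun=> ord0]) => b _; rewrite linear0l normr0 mulr0.
have [t [neg [k [t0 t_le y4 yk]]]] := ray_meets_face u0 q1.
have [z z_near] := face_node_near (ltr0n _ 4) n0 y4 yk.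
exists z => b; set e := _ - _ in z_near.
have -> : cube_node z = q + t *: u + e by rewrite /e addrC subrK.
have -> : q + t *: u + e - q = t *: u + e by rewrite addrC -addrA addKr.
move=> /(nearest_point_dot t0)/le_trans; apply.
rewrite invfM mulrA ler_pM ?invr_ge0 ?(ltW t0)// ?divr_ge0 ?dotvv_ge0//.
rewrite ler_pdivrMr// (le_trans (dotvv_le_sqr_norm _))//.
have : `|e| ^+ 2 <= (2 * 4 / n%:R) ^+ 2 by rewrite lerXn2r ?nnegrE// divr_ge0.
move=> /(ler_wpM2l (ler0n R d.+1))/le_trans; apply.
have nz : n%:R != 0 :> R by rewrite pnatr_eq0 -lt0n.
by rewrite (_ : d.+1%:R * _ = net_error d.+1 n * 2)// /net_error; field.
Qed.

Lemma nearest_point_exists D x (y : 'rV[R]_d.+1) : D != set0 ->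
  exists2 j, j \in D &
    forall i, i \in D -> dot (y - x j) (y - x j) <= dot (y - x i) (y - x i).
Proof.
case/set0Pn => p pD.
case: (@arg_minP _ _ _ p (mem D) (fun i => dot (y - x i) (y - x i)) pD) => j jD j_min.
by exists j.
Qed.

Lemma unit_cube_kernel_exists D x n :
    (0 < n)%N -> D != set0 -> (forall i, i \in D -> `|x i| <= 1) ->
  exists S : {set I}, [/\ S \subset D, (#|S| <= net_size d.+1 n)%N
    & forall u i, i \in D ->
      exists2 j, j \in S & dot u (x i - x j) <= net_error d.+1 n * `|u|].
Proof.
move=> n0 D0 x1; have /fin_all_exists2[nearest nearestD nearest_min] :=
  fun z : face_node_label d n => nearest_point_exists x (cube_node z) D0.
exists [set nearest z | z in predT]; split.
- by apply/subsetP => _ /imsetP[z _ ->].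
- by rewrite (leq_trans (leq_imset_card _ _))// -card_face_node_label max_card.
move=> u i iD; have [z z_dot] := nearer_face_node_dot u n0 (x1 i iD).
by exists (nearest z); rewrite ?imset_f// z_dot// nearest_min.
Qed.

(* In the coordinates of a barycentric spanner the points lie in the unit cube
   and the functional [dot u] has norm at most the width of [D]. *)
Lemma eps_kernel_exists D x n : (0 < n)%N -> D != set0 ->
  exists2 S : {set I}, (#|S| <= net_size d.+1 n)%N
    & eps_kernel x (net_error d.+1 n) S D.
Proof.
move=> n0 D0; have /set0Pn[p pD] := D0.
have [v [l [vD l1 xE]]] := barycentric_spanner_exists (fun i => x i - x p) D0.
have [S [SD cardS kerS]] := unit_cube_kernel_exists n0 D0 l1.
exists S => //; split=> // u.
pose w : 'rV[R]_d.+1 := \row_k dot u (x (v k) - x p).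
have dot_wl i : i \in D -> dot u (x i - x p) = dot w (l i).
  move=> iD; rewrite xE// linear_sumr; apply: eq_bigr => k _.
  by rewrite mxE linearZr_LR/= mulrC.
have w_le : `|w| <= dir_width x D u.
  apply/mx_norm_leP => [|i k]; first exact: dir_width_ge0.
  rewrite mxE ler_norml dot_le_dir_width// andbT lerNl -linearNr opprB.
  exact: dot_le_dir_width.
have [j0 j0S _] := kerS w p pD.
case: (@arg_maxP _ _ _ j0 (mem S) (fun i => dot u (x i)) j0S) => j jS j_max.
exists j => // i iD; have [k kS k_le] := kerS w i iD.
have {}k_le := le_trans k_le (ler_wpM2l (net_error_ge0 _ _ _) w_le).
rewrite (le_trans _ k_le)// [leRHS]linearBr/= -!dot_wl ?(subsetP SD k)//.
by rewrite !linearBr /=; have := j_max k kS => /=; lra.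
Qed.

Lemma peeled_kernel_exists D x n k : (0 < n)%N ->
  exists2 S : {set I}, (#|S| <= k * net_size d.+1 n)%N
    & peeled_kernel x (net_error d.+1 n) k S D.
Proof.
move=> n0; elim: k => [|k [S cardS peeledS]].
  exists set0; first by rewrite cards0.
  by right; split=> [|u]; [|exists set0; split; rewrite ?cards0// => i j _];
    rewrite ?sub0set ?inE.
have [/eqP DS|DS] := eqVneq (D :\: S) set0.
  exists S; first by rewrite (leq_trans cardS)// leq_mul2r leqnSn orbT.
  by left; apply/eqP; rewrite eqEsubset (peeled_kernel_sub peeledS) -setD_eq0.
have [S' cardS' kerS'] := eps_kernel_exists x n0 DS.
exists (S' :|: S); last exact: peeled_kernelS (net_error_ge0 _ _ _) peeledS kerS'.
by rewrite mulSn (leq_trans (leq_card_setU _ _))// leq_add.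
Qed.

End DeterministicKernels.

(** * Expected width *)

Section Support.
Variables (R : realType) (d : nat).
Implicit Types (X : {fset 'rV[R]_d}) (u v : 'rV[R]_d).

Lemma support_fun_ge X u v : v \in X -> dot u v <= support_fun X u.
Proof.
move=> vX; have : v \in enum_fset X := vX.
rewrite /support_fun; case: (enum_fset X) => // w s.
by rewrite inE => /predU1P[->|vs]; [exact: bigmax_ge_id|exact: le_bigmax_seq].
Qed.

Lemma support_fun_attained X u v : v \in X ->
  exists2 w, w \in X & support_fun X u = dot u w.
Proof.
move=> vX; suff [w ws ->] : exists2 w, w \in enum_fset X & support_fun X u = dot u w.
  by exists w.
have : v \in enum_fset X := vX.
rewrite /support_fun; case: (enum_fset X) => // w s _.
elim: s => [|a s [b bs IHs]]; first by exists w; rewrite ?inE ?big_nil.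
rewrite big_cons IHs; case: leP => _; last by exists a; rewrite ?inE ?eqxx ?orbT.
by exists b => //; move: bs; rewrite !inE => /orP[->|->]; rewrite ?orbT.
Qed.

End Support.

Lemma prodr_natb (R : comPzSemiRingType) (I : finType) (c : pred I) :
  \prod_v (c v)%:R = [forall v, c v]%:R :> R.
Proof.
have [/forallP cT|] := boolP [forall v, c v]; first by rewrite big1// => v _; rewrite cT.
by rewrite negb_forall => /existsP[v /negPf cv]; rewrite (bigD1 v)//= cv mul0r.
Qed.

Section Realization.
Variables (R : realType) (d : nat) (P : stoch_points R d).
Implicit Types (A T : {set P}) (u : 'rV[R]_d).
Local Notation locs := (@loc R d P).

Lemma support_realization_ge A u v : v \in A ->
  dot u (loc v) <= support_fun (realization A) u.
Proof. by move=> vA; apply: support_fun_ge; rewrite in_imfset. Qed.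

Lemma support_realization_attained A u : A != set0 ->
  exists2 v, v \in A & support_fun (realization A) u = dot u (loc v).
Proof.
case/set0Pn => v vA.
have lvA : loc v \in realization A by rewrite in_imfset.
by have [w /imfsetP[x xA ->] ->] := support_fun_attained u lvA; exists x.
Qed.

Lemma support_realization0 u : support_fun (realization (set0 : {set P})) u = 0.
Proof.
rewrite /support_fun; case E: (enum_fset _) => [//|w s].
suff /imfsetP[v /=] : w \in realization (set0 : {set P}) by rewrite finset.in_set0.
by rewrite -[_ \in _]/(w \in enum_fset _) E mem_head.
Qed.

Lemma width_realization A u : width (realization A) u = dir_width locs A u.
Proof.
have [->|A0] := eqVneq A set0.
  rewrite /width !support_realization0 addr0; apply: le_anti.
  by rewrite dir_width_ge0 dir_width_le// => a b; rewrite finset.in_set0.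
apply: le_anti; apply/andP; split; rewrite /width.
  have [a aA ->] := support_realization_attained u A0.
  have [b bA ->] := support_realization_attained (- u) A0.
  by rewrite linearNl -linearBr dot_le_dir_width.
have width_ge a b : a \in A -> b \in A ->
    dot u (loc a - loc b) <= support_fun (realization A) u + support_fun (realization A) (- u).
  by move=> aA bA; rewrite linearBr/= lerD// -?linearNl support_realization_ge.
apply: dir_width_le => //; have /set0Pn[a aA] := A0.
by rewrite (le_trans _ (width_ge a a aA aA))// subrr linear0r.
Qed.

Lemma realization_prob_ge0 A : 0 <= realization_prob A.
Proof.
by apply: mulr_ge0; apply: prodr_ge0 => v _; have /andP[] := prob_itv v;
  rewrite ?subr_ge0.
Qed.

Lemma realization_probE A :
  realization_prob A = \prod_v (if v \in A then prob v else 1 - prob v).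
Proof.
rewrite /realization_prob [RHS](bigID (mem A)) /=; congr (_ * _).
  by apply: eq_bigr => v ->.
by apply: eq_big => [v|v]; rewrite inE// => /negPf->.
Qed.

Lemma sum_realization_prob_prod (g : P -> bool -> R) :
  \sum_(A : {set P}) realization_prob A * \prod_v g v (v \in A) =
  \prod_v (prob v * g v true + (1 - prob v) * g v false).
Proof.
rewrite bigA_distr; apply: eq_bigr => A _.
rewrite realization_probE -big_split; apply: eq_bigr => v _ /=.
by case: ifP.
Qed.

Lemma sum_realization_prob_event (c : P -> bool -> bool) (e : {set P} -> bool) :
    (forall A, e A = [forall v, c v (v \in A)]) ->
  \sum_(A : {set P}) realization_prob A * (e A)%:R =
  \prod_v (prob v * (c v true)%:R + (1 - prob v) * (c v false)%:R).
Proof.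
move=> eE; rewrite -(sum_realization_prob_prod (fun v b => (c v b)%:R)).
by apply: eq_bigr => A _; rewrite prodr_natb eE.
Qed.

Lemma sum_realization_prob_disjoint T :
  \sum_(A : {set P}) realization_prob A * [disjoint T & A]%:R =
  \prod_(v in T) (1 - prob v).
Proof.
rewrite (@sum_realization_prob_event (fun v b => (v \in T) ==> ~~ b)) => [|A].
  rewrite [RHS]big_mkcond; apply: eq_bigr => v _.
  by case: (v \in T); rewrite /= ?mulr0 ?mulr1 ?add0r// addrC subrK.
rewrite disjoint_subset; apply/subsetP/forallP => TA v.
  by apply/implyP => /TA; rewrite inE.
by move=> vT; have := TA v; rewrite vT inE.
Qed.

Lemma sum_realization_prob_subset T :
  \sum_(A : {set P}) realization_prob A * (T \subset A)%:R = \prod_(v in T) prob v.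
Proof.
rewrite (@sum_realization_prob_event (fun v b => (v \in T) ==> b)) => [|A].
  rewrite [RHS]big_mkcond; apply: eq_bigr => v _.
  by case: (v \in T); rewrite /= ?mulr0 ?mulr1 ?addr0// addrC subrK.
apply/subsetP/forallP => TA v; first by apply/implyP => /TA.
by move=> vT; have := TA v; rewrite vT.
Qed.

Lemma sum_realization_prob : \sum_(A : {set P}) realization_prob A = 1.
Proof.
have := sum_realization_prob_subset set0; rewrite big_set0 => <-.
by apply: eq_bigr => A _; rewrite sub0set mulr1.
Qed.

Lemma exp_widthE u :
  exp_width P u = \sum_(A : {set P}) realization_prob A * dir_width locs A u.
Proof. by apply: eq_bigr => A _; rewrite width_realization. Qed.

Lemma exp_width_ge0 u : 0 <= exp_width P u.
Proof.
by rewrite exp_widthE sumr_ge0// => A _; rewrite mulr_ge0 ?realization_prob_ge0 ?dir_width_ge0.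
Qed.

(* The two points spanning the width are present together with probability at
   least [beta ^+ 2]. *)
Lemma dir_width_le_exp_width (beta : R) u : 0 < beta -> (forall v : P, beta <= prob v) ->
  beta ^+ 2 * dir_width locs setT u <= exp_width P u.
Proof.
move=> b0 bP; have b2 : 0 < beta ^+ 2 by rewrite exprn_gt0.
rewrite mulrC -ler_pdivlMr//; apply: dir_width_le => [|a b _ _].
  by rewrite divr_ge0 ?exp_width_ge0 ?ltW.
have [->|ab] := eqVneq a b.
  by rewrite subrr linear0r divr_ge0 ?exp_width_ge0 ?ltW.
have [dot_lt0|dot_ge0] := ltP (dot u (loc a - loc b)) 0.
  by rewrite (le_trans (ltW dot_lt0))// divr_ge0 ?exp_width_ge0 ?ltW.
have : beta ^+ 2 <= \prod_(v in [set a; b]) prob v.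
  by rewrite big_setU1 ?inE//= big_set1 expr2 ler_pM ?bP ?(ltW b0).
rewrite ler_pdivlMr// -sum_realization_prob_subset => /(ler_wpM2l dot_ge0)/le_trans; apply.
rewrite exp_widthE mulr_sumr; apply: ler_sum => A _.
rewrite mulrCA ler_wpM2l ?realization_prob_ge0//.
have [/subsetP abA|_] := boolP (_ \subset A); last by rewrite mulr0 dir_width_ge0.
by rewrite mulr1 dot_le_dir_width// abA// !inE eqxx ?orbT.
Qed.

Lemma prod_absent_le_expR (beta : R) T : (forall v : P, beta <= prob v) ->
  \prod_(v in T) (1 - prob v) <= expR (- beta * #|T|%:R).
Proof.
move=> bP; rewrite expRM_natr -prodr_const; apply: ler_prod => v _.
have /andP[_ p1] := prob_itv v; rewrite subr_ge0 p1 /=.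
by rewrite (le_trans _ (expR_ge1Dx _))// lerD2l lerN2.
Qed.

End Realization.

Lemma exp_width_dim0 (R : realType) (P : stoch_points R 0) u : exp_width P u = 0.
Proof.
rewrite exp_widthE big1// => A _; suff -> : dir_width (@loc _ _ P) A u = 0 by rewrite mulr0.
apply: le_anti; rewrite dir_width_ge0 andbT.
by apply: dir_width_le => // a b _ _; rewrite /dot big_ord0.
Qed.

Section Restriction.
Variables (R : realType) (d : nat) (P : stoch_points R d).
Implicit Types (A S T : {set P}) (u : 'rV[R]_d).
Local Notation locs := (@loc R d P).

Definition restrict_points (S : {set P}) : stoch_points R d :=
  @StochPoints R d {v : P | v \in S} (fun v => loc (val v)) (fun v => prob (val v))
    (fun v => prob_itv (val v)).

Lemma restrict_points_subset S : subset_constraint (restrict_points S) P.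
Proof. by exists (fun v => val v); split=> //; apply: val_inj. Qed.

Lemma card_restrict_points S : #|restrict_points S| = #|S|.
Proof. exact: card_sig. Qed.

Definition restrict_set S A : {set restrict_points S} := [set w | val w \in A].

Lemma realization_restrict_set S A :
  realization (restrict_set S A) = realization (A :&: S).
Proof.
apply/fsetP => x; apply/imfsetP/imfsetP => -[v /= vA ->].
  by exists (val v) => //; rewrite inE (valP v) andbT; rewrite inE in vA.
by case/setIP: vA => vA vS; exists (exist _ v vS) => //=; rewrite inE.
Qed.

Lemma realization_prob_restrict S (B : {set restrict_points S}) :
  \sum_(A | restrict_set S A == B) realization_prob A = realization_prob B.
Proof.
rewrite big_mkcond; under eq_bigr => A _ do rewrite -mulrb -mulr_natr.
rewrite (sum_realization_prob_event
  (c := fun v b => (v \in S) ==> (b == (v \in val @: B)))) => [|A].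
  rewrite realization_probE (bigID (mem S)) /= [X in _ * X]big1 ?mulr1 => [|v /negPf->].
    rewrite big_sub; apply: eq_bigr => w _; rewrite (valP w) /= mem_imset; last exact: val_inj.
    by case: (w \in B); rewrite /= ?mulr0 ?mulr1 ?addr0 ?add0r.
  by rewrite /= !mulr1 addrC subrK.
apply/eqP/forallP => [<- v|AB].
  apply/implyP => vS; rewrite -[v]/(val (exist (fun v => v \in S) v vS)).
  by rewrite mem_imset ?inE//; apply: val_inj.
apply/setP => w; have := AB (val w); rewrite (valP w) mem_imset; last exact: val_inj.
by rewrite inE => /eqP.
Qed.

Lemma expect_restrict_points S (X : {fset 'rV[R]_d} -> R) :
  expect (restrict_points S) X =
  \sum_(A : {set P}) realization_prob A * X (realization (A :&: S)).
Proof.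
rewrite [RHS](partition_big (restrict_set S) predT)//=; apply: eq_bigr => B _.
under [RHS]eq_bigr => A /eqP BE do rewrite -realization_restrict_set BE.
by rewrite -mulr_suml realization_prob_restrict.
Qed.

Lemma exp_width_restrictE S u : exp_width (restrict_points S) u =
  \sum_(A : {set P}) realization_prob A * dir_width locs (A :&: S) u.
Proof.
rewrite /exp_width expect_restrict_points.
by apply: eq_bigr => A _; rewrite width_realization.
Qed.

Lemma exp_width_restrict_le S u : exp_width (restrict_points S) u <= exp_width P u.
Proof.
rewrite exp_width_restrictE exp_widthE; apply: ler_sum => A _.
by rewrite ler_wpM2l ?realization_prob_ge0// dir_widthS// subsetIl.
Qed.

Lemma exp_width_restrictT u : exp_width (restrict_points setT) u = exp_width P u.
Proof.
by rewrite exp_width_restrictE exp_widthE; apply: eq_bigr => A _; rewrite setIT.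
Qed.

Lemma exp_width_loss S T1 T2 u c :
    0 <= c -> T1 \subset S -> T2 \subset S ->
    extreme_upto locs c T1 (setT :\: S) u ->
    extreme_upto locs c T2 (setT :\: S) (- u) ->
  exp_width P u <= exp_width (restrict_points S) u + (2 * c +
    dir_width locs setT u *
      (\prod_(v in T1) (1 - prob v) + \prod_(v in T2) (1 - prob v))).
Proof.
move=> c0 T1S T2S ext1 ext2; set W := dir_width _ setT u.
rewrite exp_width_restrictE exp_widthE -!sum_realization_prob_disjoint.
have -> : 2 * c = \sum_(A : {set P}) realization_prob A * (2 * c).
  by rewrite -mulr_suml sum_realization_prob mul1r.
rewrite mulrDr !mulr_sumr -!big_split; apply: ler_sum => A _ /=.
rewrite ![W * (_ * _)]mulrCA -!mulrDr ler_wpM2l ?realization_prob_ge0//.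
have AT := subsetT A; have : dir_width locs A u <= W by apply: dir_widthS.
have W0 : 0 <= W := dir_width_ge0 _ _ _.
have AS_ge0 := dir_width_ge0 locs (A :&: S) u.
have [_|meet1] := boolP [disjoint T1 & A].
  by case: [disjoint T2 & A]; rewrite ?mulr1n ?mulr0n; lra.
have [_|meet2] := boolP [disjoint T2 & A]; first by rewrite mulr1n mulr0n; lra.
by rewrite !mulr0n addr0 mulr0 addr0 => _; exact: (dir_width_setI_le c0 AT T1S T2S ext1 ext2).
Qed.

Lemma exp_width_peeled_loss (beta eta : R) k S u :
    0 <= eta -> (forall v : P, beta <= prob v) ->
    peeled_kernel locs eta k S setT ->
  exp_width P u <= exp_width (restrict_points S) u +
    2 * (eta + expR (- beta * k%:R)) * dir_width locs setT u.
Proof.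
move=> eta0 bP; have W0 := dir_width_ge0 locs setT u.
have err0 : 0 <= 2 * (eta + expR (- beta * k%:R)) by rewrite mulr_ge0// addr_ge0 ?expR_ge0.
case=> [->|[_ peeled]]; first by rewrite exp_width_restrictT lerDl mulr_ge0.
have [T1 [T1S cardT1 ext1]] := peeled u; have [T2 [T2S cardT2]] := peeled (- u).
rewrite dir_widthN => ext2.
have loss := exp_width_loss (mulr_ge0 eta0 W0) T1S T2S ext1 ext2.
rewrite (le_trans loss)// lerD2l.
have absent1 := prod_absent_le_expR T1 bP; have absent2 := prod_absent_le_expR T2 bP.
rewrite cardT1 in absent1; rewrite cardT2 in absent2.
by have := ler_wpM2l W0 (lerD absent1 absent2); lra.
Qed.

Lemma exp_kernel_restrict_peeled (beta eta eps : R) k S :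
    0 < beta -> 0 <= eta -> (forall v : P, beta <= prob v) ->
    2 * (eta + expR (- beta * k%:R)) <= eps * beta ^+ 2 ->
    peeled_kernel locs eta k S setT ->
  exp_kernel eps (restrict_points S) P.
Proof.
move=> b0 eta0 bP err peeled u; rewrite exp_width_restrict_le andbT.
have eps0 : 0 <= eps.
  rewrite -(pmulr_lge0 _ (exprn_gt0 2 b0)) (le_trans _ err)// mulr_ge0//.
  by rewrite addr_ge0 ?expR_ge0.
have loss := exp_width_peeled_loss u eta0 bP peeled.
have W0 := dir_width_ge0 locs setT u.
have := ler_wpM2r W0 err; have := ler_wpM2l eps0 (dir_width_le_exp_width u b0 bP).
by lra.
Qed.

End Restriction.

(** * Choice of the parameters *)

Lemma truncn_le_norm (R : archiRealDomainType) (x : R) : (Num.truncn x)%:R <= `|x|.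
Proof.
by rewrite (@le_trans _ _ (Num.truncn `|x|)%:R) ?truncn_le// ler_nat le_truncn ?ler_norm.
Qed.

Lemma ln_inv_ge1 (R : realType) (x : R) : 0 < x <= expR (- 1) -> 1 <= ln (1 / x).
Proof.
case/andP=> x0 x1.
by rewrite div1r lnV ?posrE// lerNr -[leRHS]expRK ler_ln ?posrE ?expR_gt0.
Qed.

Lemma powR_half (R : realType) (x : R) (n : nat) : 0 <= x ->
  x `^ (n%:R / 2) = Num.sqrt x ^+ n.
Proof. by move=> x0; rewrite mulrC powRrM powR12_sqrt// powR_mulrn ?sqrtr_ge0. Qed.

Section KernelSize.
Variables (R : realType) (d : nat) (beta : R).
Hypothesis beta_gt0 : 0 < beta.

Definition grid_size (eps : R) : nat :=
  (Num.truncn (Num.sqrt (128 * d%:R / eps) / beta)).+1.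

Definition layer_count (eps : R) : nat :=
  (Num.truncn (ln (4 / (eps * beta ^+ 2)) / beta)).+1.

Definition kernel_size (eps : R) : nat :=
  layer_count eps * net_size d (grid_size eps).

Let beta2_gt0 : 0 < beta ^+ 2. Proof. by rewrite exprn_gt0. Qed.

Lemma net_error_grid_size (eps : R) : 0 < eps ->
  net_error d (grid_size eps) <= eps * beta ^+ 2 / 4.
Proof.
move=> e0; have arg0 : 0 <= 128 * d%:R / eps by rewrite divr_ge0 ?mulr_ge0// ltW.
have n0 : 0 < (grid_size eps)%:R ^+ 2 :> R by rewrite exprn_gt0// ltr0n.
have : (Num.sqrt (128 * d%:R / eps) / beta) ^+ 2 <= (grid_size eps)%:R ^+ 2.
  by rewrite lerXn2r ?nnegrE ?divr_ge0 ?sqrtr_ge0 ?(ltW beta_gt0)// ltW// truncnS_gt.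
rewrite expr_div_n sqr_sqrtr// ler_pdivrMr// ler_pdivrMr// => size_ge.
by rewrite /net_error ler_pdivrMr//; lra.
Qed.

Lemma expR_layer_count (eps : R) : 0 < eps ->
  expR (- beta * (layer_count eps)%:R) <= eps * beta ^+ 2 / 4.
Proof.
move=> e0; have q0 : 0 < 4 / (eps * beta ^+ 2) by rewrite divr_gt0// mulr_gt0.
have /ltW := truncnS_gt (ln (4 / (eps * beta ^+ 2)) / beta).
rewrite -/(layer_count eps) ler_pdivrMr// => count_ge.
rewrite -[leRHS]invrK invf_div -[(4 / _)]lnK ?posrE// -expRN ler_expR.
by rewrite mulNr lerN2 [beta * _]mulrC.
Qed.

Lemma grid_size_le (eps : R) : 0 < eps <= 1 ->
  (grid_size eps).+1%:R <= (Num.sqrt (128 * d%:R) / beta + 2) / Num.sqrt eps.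
Proof.
case/andP=> e0 e1; have r0 : 0 < Num.sqrt eps by rewrite sqrtr_gt0.
have r1 : 1 <= (Num.sqrt eps)^-1 by rewrite invf_ge1// -sqrtr1 ler_wsqrtr.
have := truncn_le_norm (Num.sqrt (128 * d%:R / eps) / beta).
rewrite ger0_norm ?divr_ge0 ?sqrtr_ge0 ?(ltW beta_gt0)// /grid_size.
rewrite (sqrtrM eps^-1) ?mulr_ge0// sqrtrV ?(ltW e0)// mulrAC => trunc_le.
by rewrite -[(Num.truncn _).+2]addn2 [leLHS]natrD [leRHS]mulrDl lerD// ler_peMr.
Qed.

Lemma layer_count_le (eps : R) : 0 < eps <= expR (- 1) ->
  (layer_count eps)%:R <=
    ((`|ln (4 / beta ^+ 2)| + 1) / beta + 1) * ln (1 / eps).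
Proof.
move=> eps_itv; have /andP[e0 _] := eps_itv; have L1 := ln_inv_ge1 eps_itv.
set L := ln (1 / eps) in L1 *; rewrite /layer_count -natr1 [leRHS]mulrDl mul1r lerD//.
rewrite (le_trans (truncn_le_norm _))// normrM normfV (gtr0_norm beta_gt0).
rewrite mulrAC ler_pM2r ?invr_gt0//.
have -> : ln (4 / (eps * beta ^+ 2)) = ln (4 / beta ^+ 2) + L.
  by rewrite -lnM ?posrE ?divr_gt0//; congr ln; field; rewrite !gt_eqF.
rewrite (le_trans (ler_normD _ _))// [leRHS]mulrDl mul1r.
by rewrite (ger0_norm (le_trans ler01 L1)) lerD2r ler_peMr.
Qed.

End KernelSize.

Lemma kernel_size_le (R : realType) (d : nat) (beta : R) : 0 < beta ->
  exists2 C : R, 0 < C & forall eps : R, 0 < eps <= expR (- 1) ->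
    (kernel_size d beta eps)%:R <=
      C * (1 / eps `^ ((d%:R - 1) / 2) * ln (1 / eps)).
Proof.
move=> beta0; case: d => [|d].
  exists 1 => // eps /ln_inv_ge1 L1.
  by rewrite /kernel_size /net_size !(muln0, mul0n) mul1r mulr_ge0 ?divr_ge0 ?powR_ge0//
    (le_trans ler01).
pose A : R := (`|ln (4 / beta ^+ 2)| + 1) / beta + 1.
pose B : R := Num.sqrt (128 * d.+1%:R) / beta + 2.
have A0 : 0 < A by rewrite ltr_wpDl// divr_ge0 ?addr_ge0// ltW.
have B0 : 0 < B by rewrite ltr_wpDl// divr_ge0 ?sqrtr_ge0// ltW.
exists (A * ((2 * d.+1)%:R * B ^+ d)); first by rewrite !mulr_gt0 ?ltr0n ?exprn_gt0.
move=> eps eps_itv; have /andP[e0 e1] := eps_itv.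
have eps_le1 : eps <= 1 by rewrite (le_trans e1)// -expR0 ler_expR; lra.
have grid_le : ((grid_size d.+1 beta eps).+1 ^ d)%:R <= B ^+ d / Num.sqrt eps ^+ d :> R.
  rewrite natrX -expr_div_n lerXn2r ?nnegrE ?divr_ge0 ?sqrtr_ge0 ?(ltW B0)//.
  by rewrite grid_size_le// e0.
rewrite -natr1 addrK powR_half ?(ltW e0)//.
rewrite [leRHS](_ : _ = A * ln (1 / eps) *
    ((2 * d.+1)%:R * (B ^+ d / Num.sqrt eps ^+ d))); last by rewrite div1r; ring.
rewrite /kernel_size /net_size natrM natrM.
by rewrite ler_pM ?layer_count_le// ler_pM2l ?ltr0n.
Qed.

Lemma exp_kernel_exists (R : realType) (d : nat) (P : stoch_points R d) (beta eps : R) :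
    0 < beta -> (forall v : P, beta <= prob v) -> 0 < eps ->
  exists S : stoch_points R d,
    [/\ exp_kernel eps S P, subset_constraint S P
      & (#|S| <= kernel_size d beta eps)%N].
Proof.
move=> beta0; case: d P => [|d] P prob_ge eps0.
  exists (restrict_points (set0 : {set P})); split.
  - by move=> u; rewrite !exp_width_dim0 mulr0 lexx.
  - exact: restrict_points_subset.
  - by rewrite card_restrict_points cards0.
have [S cardS peeledS] := peeled_kernel_exists setT (@loc _ _ P)
  (layer_count beta eps) (ltn0Sn _ : 0 < grid_size d.+1 beta eps)%N.
exists (restrict_points S); split; last by rewrite card_restrict_points.
- apply: (exp_kernel_restrict_peeled beta0 (net_error_ge0 _ _ _) prob_ge _ peeledS).
  have := net_error_grid_size d.+1 beta0 eps0; have := expR_layer_count beta0 eps0.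
  by lra.
- exact: restrict_points_subset.
Qed.

Local Open Scope classical_set_scope.

Lemma kernel_size_bigO (R : realType) (d : nat) (beta : R) : 0 < beta ->
  (fun eps : R => (kernel_size d beta eps)%:R : R) =O_ (0^'+)
    (fun eps : R => 1 / (eps `^ ((d%:R - 1) / 2)) * ln (1 / eps)).
Proof.
move=> beta0; have [C C0 size_le] := kernel_size_le d beta0.
apply/eqO_exP; exists C => //; near=> eps.
rewrite ger0_norm// (le_trans (size_le eps _)) ?ler_pM2l ?ler_norm//.
by apply/andP; split; near: eps; [exact: nbhs_right_gt|exact/nbhs_right_le/expR_gt0].
Unshelve. all: by end_near.
Qed.

Theorem mainTheorem10 (R : realType) (d : nat) (beta : R) (hbeta : 0 < beta) :
  exists g : R -> R,
    (g =O_ (0^'+) (fun eps : R =>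
                    1 / (eps `^ ((d%:R - 1) / 2)) * ln (1 / eps))) /\
    (forall (P : stoch_points R d), (forall v : P, beta <= prob v) ->
     forall eps : R, 0 < eps ->
       exists S : stoch_points R d,
         [/\ exp_kernel eps S P,
             subset_constraint S P
           & (#|S|)%:R <= g eps]).
Proof.
exists (fun eps => (kernel_size d beta eps)%:R); split; first exact: kernel_size_bigO.
move=> P prob_ge eps eps0.
have [S [kerS subS cardS]] := exp_kernel_exists hbeta prob_ge eps0.
by exists S; split=> //; rewrite ler_nat.
Qed.
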